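(* Let $X$ be a complete metric space, $A \subset X$ a closed set, and let the functions $f$ and $x \mapsto d(0, G(x))$ be l.s.c. on $A$. Suppose also that there exist $\delta > 0$ and $\lambda_0 \ge 0$ such that: (1) $f$ is Lipschitz continuous on the set $$K(\delta, \lambda_0) := \{ x \in A \mid d(0, G(x)) < \delta,\ f(x) + \lambda_0\, d(0, G(x)) < f^* \},$$ and upper semicontinuous at every point of this set; (2) there exists $a > 0$ such that $d(0, G(\cdot))^{\downarrow}_A(x) < - a$ for any $x \in K(\delta, \lambda_0)$; (3) there exist $\phi_0, \Phi_0, \omega_0, \Omega_0, t_0 > 0$ such that $\phi_0 t \le \phi(t) \le \Phi_0 t$ and $\omega_0 t \le \omega(t) \le \Omega_0 t$ for all $t \in [0, t_0]$. Then the singular penalty function $F_{\lambda}$ is (globally) exact if and only if it is bounded below on $A \times \mathbb{R}_+$ for some $\lambda \ge 0$.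
   Context: Setting. $Y$ is a normed space, $A \subset X$ nonempty, $f \colon X \to \mathbb{R} \cup \{+\infty\}$, and $G \colon X \rightrightarrows Y$ a set-valued mapping with closed values. The problem $(\mathcal{P})$ is: minimize $f(x)$ subject to $0 \in G(x)$, $x \in A$; its feasible set is $\Omega = \{x \in A : 0 \in G(x)\}$. It is assumed that $f$ attains a global minimum on $\Omega$, with finite value $f^*$. $\mathbb{R}_+ = [0,+\infty)$. Singular penalty function. Fix $w \in Y$ and non-decreasing functions $\phi \colon [0, +\infty] \to [0, +\infty]$, $\omega \colon \mathbb{R}_+ \to [0, +\infty]$ such that $\phi(t) = 0$ iff $t = 0$ and $\omega(t) = 0$ iff $t = 0$. For $(x,p) \in X \times \mathbb{R}_+$ put $\varphi(x,p) = 0$ if $x \in \Omega$, $p = 0$; $\varphi(x,p) = +\infty$ if $x \notin \Omega$, $p = 0$; and $\varphi(x,p) = p^{-1} \phi( d(0, G(x) - p w)^2 ) + \omega(p)$ if $p > 0$, where $d(0, G(x) - pw) = \inf_{y \in G(x)} \|y - pw\|$ if $G(x) \neq \emptyset$, and $= +\infty$ if $G(x) = \emptyset$. The singular penalty function is $F_\lambda(x,p) = f(x) + \lambda \varphi(x,p)$, $\lambda \ge 0$. Global exactness: there exists $\lambda_0 \ge 0$ such that $F_{\lambda_0}$ attains a global minimum on $A \times \mathbb{R}_+$, and $(x^*, p^* )$ is a global minimizer of $F_{\lambda_0}$ on $A\times \mathbb{R}_+$ iff $p^* = 0$ and $x^*$ is a globally optimal solution of $(\mathcal{P})$. Rate of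 steepest descent: for a function $h \colon X \to [-\infty,+\infty]$ and $x \in A$ with $h(x)$ finite, $h^{\downarrow}_A(x) = \liminf_{y \to x,\, y \in A,\, y\neq x} \frac{h(y) - h(x)}{d(y, x)}$, and $h^{\downarrow}_A(x) = +\infty$ if $x$ is an isolated point of $A$; $d(0,G(\cdot))^{\downarrow}_A$ is this rate for $h(x) = d(0,G(x))$. ''L.s.c. on a set'' means lower semicontinuous at every point of that set. *)

(* Defs.v *)
From HB Require Import structures.
From mathcomp Require Import all_boot all_order all_algebra.
From mathcomp Require Import all_classical all_reals all_analysis.

Set Implicit Arguments.
Unset Strict Implicit.
Unset Printing Implicit Defensive.

Import Order.TTheory GRing.Theory Num.Theory.
Import numFieldNormedType.Exports.

Local Open Scope classical_set_scope.
Local Open Scope ring_scope.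
Local Open Scope ereal_scope.

#[short(type="completeMetricType")]
HB.structure Definition CompleteMetric (R : numDomainType) :=
  {T of Complete T & Metric R T}.

Section metric_notions.
Context {R : realType} {X : metricType R}.
Implicit Types (h : X -> \bar R) (A : set X).

(* Neighbourhoods are taken in the whole space X, not relative to a subset. *)
Definition lsc_at h (x : X) : Prop :=
  forall r : R, r%:E < h x -> \forall y \near x, r%:E < h y.

Definition usc_at h (x : X) : Prop :=
  forall r : R, h x < r%:E -> \forall y \near x, h y < r%:E.

Definition lipschitz_continuous_on A h : Prop :=
  exists2 L : R, (0 <= L)%R &
    forall x y, A x -> A y ->
      [/\ h x \is a fin_num, h y \is a fin_num &
          `|h x - h y| <= (L * mdist x y)%:E].

(* Meaningful only for x in A with h x finite; when h y = +oo the quotient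
   is +oo. *)
Definition steepest_descent_rate A h (x : X) : \bar R :=
  if `[< isolated A x >] then +oo
  else limf_einf (fun y => (h y - h x) * ((mdist y x)^-1)%:E) (within A x^').

End metric_notions.

(* d(0, S) as an extended real: it is +oo when S is empty. *)
Definition dist0 {R : realType} {Y : normedModType R} (S : set Y) : \bar R :=
  ereal_inf [set `|y|%:E | y in S].

Section singular_penalty.
Context {R : realType} {X : metricType R} {Y : normedModType R}.
Variables (A : set X) (f : X -> \bar R) (G : X -> set Y).

Definition feasible : set X := [set x | A x /\ G x 0%R].

Definition optimal_solution (x : X) : Prop :=
  feasible x /\ forall y, feasible y -> f x <= f y.

Definition optimal_value (fstar : R) : Prop :=
  exists2 x, optimal_solution x & f x = fstar%:E.

Definition Kset (fstar delta lambda0 : R) : set X :=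
  [set x | [/\ A x, dist0 (G x) < delta%:E &
               f x + lambda0%:E * dist0 (G x) < fstar%:E]].

Variables (w : Y) (phi : \bar R -> \bar R) (omega : R -> \bar R).

(* Only the values at p >= 0 are meaningful. *)
Definition penalty_term (x : X) (p : R) : \bar R :=
  if p == 0%R then (if `[< feasible x >] then 0 else +oo)
  else (p^-1)%:E * phi (dist0 [set (y - p *: w)%R | y in G x] ^+ 2) + omega p.

(* For lambda = 0 the library convention 0 * +oo = 0 applies. *)
Definition singular_penalty (lambda : R) (x : X) (p : R) : \bar R :=
  f x + lambda%:E * penalty_term x p.

Definition global_minimizer (lambda : R) (x : X) (p : R) : Prop :=
  [/\ A x, (0 <= p)%R &
      forall y q, A y -> (0 <= q)%R ->
        singular_penalty lambda x p <= singular_penalty lambda y q].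

Definition globally_exact : Prop :=
  exists2 lambda : R, (0 <= lambda)%R &
    (exists x p, global_minimizer lambda x p) /\
    (forall x p, global_minimizer lambda x p <->
                 p = 0%R /\ optimal_solution x).

Definition penalty_bounded_below (lambda : R) : Prop :=
  exists c : R, forall x p, A x -> (0 <= p)%R ->
    c%:E <= singular_penalty lambda x p.

End singular_penalty.

Section penalty_parameters.
Context {R : realType}.

(* phi stands for a function [0, +oo] -> [0, +oo] and omega for a function
   [0, +oo[ -> [0, +oo]; their values at negative arguments are irrelevant. *)
Definition penalty_phi (phi : \bar R -> \bar R) : Prop :=
  [/\ forall t, 0 <= t -> 0 <= phi t,
      forall s t, 0 <= s -> s <= t -> phi s <= phi t &
      forall t, 0 <= t -> (phi t = 0 <-> t = 0)].

Definition penalty_omega (omega : R -> \bar R) : Prop :=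
  [/\ forall t, (0 <= t)%R -> 0 <= omega t,
      forall s t, (0 <= s)%R -> (s <= t)%R -> omega s <= omega t &
      forall t, (0 <= t)%R -> (omega t = 0 <-> t = 0%R)].

End penalty_parameters.

(* Main.v *)
(* Along K, a unit step of the descent lowers d(0, G(x)) by more than a while
   f grows by at most its Lipschitz constant L.  Hence a point minimal in the
   sense of Ekeland for d(0, G(x)) on a sublevel set of f + mu d(0, G(x)), with
   mu a >= L, cannot lie in K, and f + mu d(0, G(x)) >= f* wherever
   d(0, G(x)) < delta.  For the singular penalty, write r = d(0, G(x) - p w):
   either the penalty term is bounded away from 0, and boundedness below of F
   suffices, or it dominates phi0 r^2 / p + omega0 p, which by AM-GM controls
   mu (r + p |w|) >= mu d(0, G(x)).  So F exceeds f* for every p > 0. *)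

Require Import Defs.
From mathcomp Require Import all_boot all_order all_algebra.
From mathcomp Require Import all_classical all_reals all_analysis.
From mathcomp Require Import ring lra.
Import Order.TTheory GRing.Theory Num.Theory.
Import numFieldNormedType.Exports.

Set Implicit Arguments.
Unset Strict Implicit.
Unset Printing Implicit Defensive.

Local Open Scope classical_set_scope.
Local Open Scope ring_scope.

(** * Ekeland's variational principle *)

(** Lower semicontinuity is asked only relative to [S]: the intended [h] is [fine] of an extended
    distance, which drops to 0 where that distance is [+oo]. *)
Lemma ekeland (R : realType) (X : completeMetricType R) (S : set X)
  (h : X -> R) (a : R) :
  closed S -> S !=set0 -> 0 < a -> (forall x, S x -> 0 <= h x) ->
  (forall x r, S x -> r < h x -> \forall y \near x, S y -> r < h y) ->
  exists2 x, S x & forall y, S y -> h y + a * mdist y x <= h x -> y = x.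
Proof.
move=> Scl [x0 Sx0] a0 h0 hlsc.
(* [T x] collects the points below [x] in Ekeland's order; the goal is a point [l] with nothing but
   [l] below it. *)
pose T (x : X) := [set z | S z /\ h z + a * mdist z x <= h x].
have Txx x : S x -> T x x by move=> Sx; split=> //; rewrite mdistxx mulr0 addr0.
have Ttrans x y z : T x y -> T y z -> T x z.
  move=> [_ yx] [Sz zy]; split=> //.
  have := metric_triangle z y x; rewrite -(ler_pM2l a0) mulrDr; lra.
(* The values h (u n) nearly attain the infimum of h over T (u n), so the
   sets T (u n) shrink to the limit point l. *)
have next (p : nat * X) : exists y, S p.2 ->
    T p.2 y /\ forall z, T p.2 z -> h y <= h z + p.1.+1%:R^-1.
  have [Sx|nSx] := pselect (S p.2); last by exists p.2.
  have Tinf : has_inf (h @` T p.2).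
    split; first by exists (h p.2), p.2 => //; exact: Txx.
    exists 0 => _ [z [Sz _] <-]; exact: h0.
  have e0 : 0 < p.1.+1%:R^-1 :> R by rewrite invr_gt0.
  have [_ [y Ty <-] hy] := inf_adherent e0 Tinf.
  exists y => _; split=> // z Tz; apply: (le_trans (ltW hy)).
  by rewrite lerD2r; apply: ge_inf; [exact: Tinf.2|exists z].
have [g gP] := choice next.
pose u := fix u n := if n is m.+1 then g (m, u m) else x0.
have Su n : S (u n).
  by elim: n => //= n /(gP (n, _)) [[]].
have Tu n k : T (u n) (u (n + k)%N).
  elim: k => [|k IH]; first by rewrite addn0; exact: Txx.
  apply: (Ttrans _ _ _ IH); rewrite addnS.
  by have [] := gP ((n + k)%N, u (n + k)%N) (Su _).
have uinf : has_inf (range (h \o u)).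
  split; [by exists (h x0), 0%N|by exists 0 => _ [n _ <-]; exact: h0 (Su n)].
(* Once [h (u n)] is within [a * e] of the infimum along the sequence, each later [u m] lies in
   [T (u n)], hence within [e] of [u n]. *)
have ucauchy : cauchy (u @ \oo).
  apply: (cauchy_exP (R := R)) => e e0.
  have [_ [n _ <-] /= hn] := inf_adherent (mulr_gt0 a0 e0) uinf.
  exists (u n); exists n => // m /= nm.
  rewrite ballEmdist /= -(ltr_pM2l a0) metric_sym.
  have [_] := Tu n (m - n)%N; rewrite subnKC// => hm.
  have : inf (range (h \o u)) <= h (u m).
    by apply: ge_inf; [exact: uinf.2|exists m].
  lra.
have [l ul] : exists l : X, u @ \oo --> l.
  by exists (lim (u @ \oo)); exact: cauchy_cvg.
have Sl : S l by apply: (closed_cvg _ Scl _ _ ul); exact: nearW.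
(* If this failed by [e], then for large [m] semicontinuity at [l] and the distance from [l] to
   [u m], times [a], would each account for less than [e / 2], against [T (u n) (u m)]. *)
have Tl n : T (u n) l.
  split=> //; rewrite leNgt; apply/negP => H.
  pose e := h l + a * mdist l (u n) - h (u n).
  have e0 : 0 < e / 2 by rewrite divr_gt0// subr_gt0.
  have lt1 : h l - e / 2 < h l by rewrite ltrBlDr ltrDl.
  have N1 : \forall m \near \oo, h l - e / 2 < h (u m).
    have /ul := hlsc _ _ Sl lt1.
    by apply: (@filterS _ \oo) => m; apply; exact: Su.
  have N2 : \forall m \near \oo, mdist l (u m) < e / 2 / a.
    have /ul := nbhsx_ballx l _ (divr_gt0 e0 a0).
    by apply: (@filterS _ \oo) => m; rewrite ballEmdist.
  have [m [[hm dm] nm]] := filter_ex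
    (filterI (filterI N1 N2) (nbhs_infty_ge n)).
  have [_] := Tu n (m - n)%N; rewrite subnKC// => hn.
  have := metric_triangle l (u m) (u n); rewrite -(ler_pM2l a0) mulrDr.
  move: dm; rewrite ltr_pdivlMr// mulrC.
  rewrite /e in hm *; lra.
exists l => // y Sy hy.
have Tly : T l y by split.
(* By transitivity [y] lies in every [T (u k)], over which [h (u k.+1)] is minimal up to
   [k.+1%:R^-1]. *)
have hly : h l <= h y.
  apply/ler_addgt0Pr => e e0.
  have [k /= ke] := filter_ex (near_infty_natSinv_lt (PosNum e0)).
  have hk : h (u k.+1) <= h y + e.
    rewrite (le_trans _ (lerD (lexx _) (ltW ke)))//.
    by have [_] := gP (k, u k) (Su k); apply; exact: Ttrans (Tl k) Tly.
  have [_] := Tl k.+1; have := mulr_ge0 (ltW a0) (mdist_ge0 l (u k.+1)).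
  lra.
have : a * mdist y l <= 0 by lra.
rewrite pmulr_rle0// le_eqVlt ltNge mdist_ge0 orbF => /eqP.
exact: mdist_positivity.
Qed.

Local Open Scope ereal_scope.

(** * Semicontinuity and descent for extended-valued functions *)

Lemma lsc_atD_scale (R : realType) (X : metricType R) (f d : X -> \bar R)
  (mu : R) (x : X) :
  (0 <= mu)%R -> f x != -oo -> d x \is a fin_num ->
  lsc_at f x -> lsc_at d x -> lsc_at (fun y => f y + mu%:E * d y) x.
Proof.
move=> mu0 fx dx flsc dlsc r.
case sd : (d x) dx => [s| |] // _.
rewrite -EFinM => rx.
(* Since [f x] may be [+oo], a real [t] below it takes its place. *)
have [t rt tf] : exists2 t : R, (r < t + mu * s)%R & t%:E < f x.
  case: (f x) fx rx => // [u _|_ _]; last first.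
    by exists (r - mu * s + 1)%R; [lra|rewrite ltry].
  rewrite -EFinD lte_fin => rx; exists (u - (u + mu * s - r) / 2)%R; first lra.
  by rewrite lte_fin; lra.
(* Dividing by [mu + 1] instead of [mu] covers [mu = 0]. *)
pose e := ((t + mu * s - r) / (mu + 1))%R.
have e0 : (0 < e)%R by rewrite divr_gt0; lra.
have mue : (mu * e < t + mu * s - r)%R.
  by rewrite /e mulrA ltr_pdivrMr; nra.
have se : (s - e)%:E < d x by rewrite sd lte_fin; lra.
apply: filterS2 (flsc _ tf) (dlsc _ se) => y ty sy.
apply: (@lt_le_trans _ _ (t%:E + mu%:E * (s - e)%:E)).
  by rewrite -EFinM -EFinD lte_fin; lra.
by apply: leeD; [exact: ltW|apply: lee_wpmul2l; [rewrite lee_fin|exact: ltW]].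
Qed.

Lemma lsc_at_closure_le (R : realType) (X : metricType R) (h : X -> \bar R)
  (S : set X) (x : X) (r : R) :
  lsc_at h x -> closure S x -> (forall y, S y -> h y <= r%:E) -> h x <= r%:E.
Proof.
move=> hlsc Sx hS; rewrite leNgt; apply/negP => /hlsc /Sx [y [Sy]].
by rewrite ltNge hS.
Qed.

(** A lower limit below [c] puts the infimum over each punctured neighbourhood in [A] below [c]; [P]
    lets the caller localize the witness. At an isolated point the rate is [+oo], which excludes the
    hypothesis. *)
Lemma steepest_descent_rate_lt (R : realType) (X : metricType R) (A : set X)
  (h : X -> \bar R) (x : X) (c : R) (P : set X) :
  steepest_descent_rate A h x < c%:E -> (\forall y \near x, P y) ->
  exists y, [/\ A y, P y, y != x &
    (h y - h x) * ((mdist y x)^-1)%:E < c%:E].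
Proof.
rewrite /steepest_descent_rate; case: ifP => // _ + Px.
rewrite limf_einfE => hc.
pose V := [set y | [/\ A y, P y & y != x]].
have VF : within A x^' V.
  by rewrite /within /dnbhs /=; apply: filterS Px => y Py yx Ay; split.
have /ereal_inf_ltP [_ [y [Ay Py yx] <-] yc] :
    ereal_inf [set (h y - h x) * ((mdist y x)^-1)%:E | y in V] < c%:E.
  by apply: le_lt_trans hc; apply: ereal_sup_ubound; exists V.
by exists y; split.
Qed.

(** * Local exactness of the linear penalty *)

Lemma local_linear_penalty (R : realType) (X : completeMetricType R)
  (A : set X) (f d : X -> \bar R) (fstar delta lambda0 a : R) :
  let K := [set x | [/\ A x, d x < delta%:E &
                        f x + lambda0%:E * d x < fstar%:E]] in
  closed A -> (0 <= lambda0)%R -> (0 < a)%R ->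
  (forall x, f x != -oo) -> (forall x, 0 <= d x) ->
  (forall x, A x -> lsc_at f x) -> (forall x, A x -> lsc_at d x) ->
  lipschitz_continuous_on K f -> (forall x, K x -> usc_at f x) ->
  (forall x, K x -> steepest_descent_rate A d x < (- a)%:E) ->
  exists2 mu : R, (0 <= mu)%R &
    forall x, A x -> d x < delta%:E -> fstar%:E <= f x + mu%:E * d x.
Proof.
move=> K Acl lam0 a0 fNy d0 flsc dlsc [L L0 Lip] usc desc.
(* [lambda0] forces the sublevel set below into [K]; [L / a] makes the decrease of [mu * d] offset
   the growth of [f]. *)
pose mu := Num.max lambda0 (L / a)%R.
have lam_mu : (lambda0 <= mu)%R by rewrite le_max lexx.
have mu0 : (0 <= mu)%R by exact: le_trans lam_mu.
have L_mu : (L <= mu * a)%R by rewrite -ler_pdivrMr// le_max lexx orbT.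
have dfin x : d x < delta%:E -> exists2 s, (0 <= s)%R & d x = s%:E.
  move=> dx; have := d0 x; case: (d x) dx => // s _; rewrite lee_fin => s0.
  by exists s.
have Kfin x : K x -> exists t s, [/\ (0 <= s)%R, f x = t%:E & d x = s%:E].
  move=> Kx; have [_ dx _] := Kx; have [s s0 ->] := dfin x dx.
  have [+ _ _] := Lip x x Kx Kx.
  by case: (f x) => // t _; exists t, s.
exists mu => // x0 Ax0 dx0; rewrite leNgt; apply/negP => fx0.
have le_lam_mu x : f x + lambda0%:E * d x <= f x + mu%:E * d x.
  by rewrite leeD2l// lee_wpmul2r.
have Kx0 : K x0 by split=> //; exact: le_lt_trans fx0.
have [t0 [s0 [s00 ft0 ds0]]] := Kfin _ Kx0.
rewrite ft0 ds0 -EFinM -EFinD lte_fin in fx0.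
rewrite ds0 lte_fin in dx0.
(* Bounding [d] by its value [s0] at the violating point, instead of by [delta], gives a closed set
   on which [d < delta] still holds. *)
pose S := [set x | [/\ A x, d x <= s0%:E &
                       f x + mu%:E * d x <= (t0 + mu * s0)%:E]].
have SK : S `<=` K.
  move=> x [Ax dx fx]; split=> //; first exact: le_lt_trans dx _.
  by apply: le_lt_trans (le_trans (le_lam_mu x) fx) _.
have Scl : closed S.
  move=> x Sx.
  have Ax : A x by apply: Acl; apply: closureS Sx => y [].
  have dx : d x <= s0%:E.
    by apply: (lsc_at_closure_le _ Sx); [exact: dlsc|move=> y []].
  have xfin : d x \is a fin_num.
    by have [|s _ ->] := dfin x; first exact: le_lt_trans dx _.
  split=> //.
  apply: (@lsc_at_closure_le _ _ (fun y => f y + mu%:E * d y) S).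
  - by apply: lsc_atD_scale => //; [exact: flsc|exact: dlsc].
  - exact: Sx.
  - by move=> y [].
have S0 : S !=set0 by exists x0; split; rewrite ?ds0// ft0.
have hlsc x r : S x -> (r < fine (d x))%R ->
    \forall y \near x, S y -> (r < fine (d y))%R.
  move=> Sx; have [_ [s [_ _ ds]]] := Kfin _ (SK _ Sx).
  rewrite ds /= => rs; have [Ax _ _] := Sx.
  have := dlsc x Ax r; rewrite ds lte_fin => /(_ rs).
  apply: filterS => y + Sy.
  by have [_ [s' [_ _ ->]]] := Kfin _ (SK _ Sy); rewrite lte_fin.
have hge0 x : S x -> (0 <= fine (d x))%R by move=> _; exact: fine_ge0.
have [x Sx xmin] := ekeland Scl S0 a0 hge0 hlsc.
have Kx := SK _ Sx; have [t [s [s_ge0 ft ds]]] := Kfin _ Kx.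
have [_ dx fx] := Sx; have [_ _ fx'] := Kx.
move: dx fx fx'; rewrite ft ds -!EFinM -!EFinD !lee_fin !lte_fin => dx fx fx'.
(* With this margin, upper semicontinuity keeps the descent point [y] in [K] once [d y <= d x]; the
   Lipschitz bound needs both points there. *)
have ftr : f x < (fstar - lambda0 * s)%:E by rewrite ft lte_fin; lra.
have [y [Ay fy yx dy]] := steepest_descent_rate_lt (desc x Kx) (usc x Kx _ ftr).
have yx0 : (0 < mdist y x)%R by rewrite mdist_gt0.
(* An infinite [d y] would make the difference quotient [+oo]. *)
have [s' dy'] : exists s', d y = s'%:E.
  have := d0 y; case: (d y) dy => // [s' _ _|]; first by exists s'.
  by rewrite ds /= gt0_mulye // lte_fin invr_gt0.
have [t' fy'] : exists t', f y = t'%:E.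
  by have := fNy y; case: (f y) fy => // t' _ _; exists t'.
move: dy; rewrite dy' ds -EFinB -EFinM lte_fin ltr_pdivrMr// => dy.
rewrite fy' lte_fin in fy.
have a_dist : (0 < a * mdist y x)%R by exact: mulr_gt0.
have s's : (s' <= s)%R by lra.
have lams : (lambda0 * s' <= lambda0 * s)%R by exact: ler_wpM2l.
have Ky : K y.
  split=> //; first by rewrite dy' lte_fin; lra.
  by rewrite fy' dy' -EFinM -EFinD lte_fin; lra.
have [_ _] := Lip y x Ky Kx.
rewrite fy' ft -EFinB abse_EFin lee_fin => /(le_trans (ler_norm _)) lip.
have Ldist := ler_wpM2r (ltW yx0) L_mu.
have := ler_wpM2l mu0 (_ : s' <= s - a * mdist y x)%R.
rewrite mulrBr mulrA => mus'.
apply/negP: yx; rewrite negbK; apply/eqP/xmin.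
  split=> //; first by rewrite dy' lee_fin; lra.
  rewrite fy' dy' -EFinM -EFinD lee_fin.
  have := mus' ltac:(lra); lra.
by rewrite dy' ds /=; lra.
Qed.

(** * Lower bounds on the singular penalty for positive [p] *)

Lemma dist0_ge0 (R : realType) (Y : normedModType R) (S : set Y) :
  0 <= dist0 S.
Proof. by apply/ereal_infP => _ [y _ <-]; rewrite lee_fin. Qed.

Lemma dist0_translate (R : realType) (Y : normedModType R) (S : set Y)
  (v : Y) : dist0 S <= dist0 [set (y - v)%R | y in S] + `|v|%:E.
Proof.
rewrite -leeBlDr//; apply/ereal_infP => _ [_ [y Sy <-] <-].
rewrite leeBlDr// -EFinD; apply: (@le_trans _ _ `|y|%:E).
  by apply: ereal_inf_lbound; exists y.
by rewrite lee_fin -[X in (`|X| <= _)%R](subrK v) ler_normD.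
Qed.

(** The floor [eta] applies when [p] or the squared distance is not small, by monotonicity of
    [omega] and [phi]. Otherwise both growth bounds apply directly, and the translation by [p *: w]
    is too short to take [G x] out of the range [delta]. *)
Lemma penalty_term_ge (R : realType) (X : metricType R) (Y : normedModType R)
  (A : set X) (G : X -> set Y) (w : Y) (phi : \bar R -> \bar R)
  (omega : R -> \bar R) (delta phi0 omega0 t0 : R) :
  penalty_phi phi -> penalty_omega omega ->
  (0 < delta)%R -> (0 < phi0)%R -> (0 < omega0)%R -> (0 < t0)%R ->
  (forall t : R, (0 <= t <= t0)%R ->
     (phi0 * t)%:E <= phi t%:E /\ (omega0 * t)%:E <= omega t) ->
  exists2 eta : R, (0 < eta)%R & forall x p, (0 < p)%R ->
    eta%:E <= penalty_term A G w phi omega x p \/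
    exists r : R, [/\ (0 <= r)%R, dist0 (G x) < delta%:E,
      dist0 (G x) <= (r + p * `|w|)%:E &
      (p^-1 * (phi0 * r ^+ 2) + omega0 * p)%:E <=
        penalty_term A G w phi omega x p].
Proof.
move=> [phi_ge0 phi_mono _] [om_ge0 om_mono _] del0 phi00 om00 t00 growth.
(* Both thresholds stay below [t0]. They also keep [p * |w|] and [r] below [delta / 2] each, so that
   their sum is below [delta]; the [+ 1] covers [w = 0]. *)
pose p0 := Num.min t0 (delta / (2 * (`|w| + 1)))%R.
pose s := Num.min t0 (delta ^+ 2 / 4)%R.
have w1 : (0 < 2 * (`|w| + 1))%R by rewrite mulr_gt0// ltr_wpDl.
have p00 : (0 < p0)%R by rewrite lt_min t00 divr_gt0.
have s0 : (0 < s)%R by rewrite lt_min t00 divr_gt0// exprn_gt0.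
have p0t0 : (p0 <= t0)%R by rewrite ge_min lexx.
have st0 : (s <= t0)%R by rewrite ge_min lexx.
have p0w : (p0 * (2 * (`|w| + 1)) <= delta)%R.
  by rewrite -ler_pdivlMr// ge_min lexx orbT.
have sdelta : (s <= delta ^+ 2 / 4)%R by rewrite ge_min lexx orbT.
(* The two entries are the floors for [p0 <= p], and for [p < p0] with squared distance at least
   [s]. *)
pose eta := Num.min (omega0 * p0)%R (p0^-1 * (phi0 * s))%R.
have eta0 : (0 < eta)%R by rewrite lt_min !mulr_gt0 ?invr_gt0.
exists eta => // x p p_gt0; rewrite /penalty_term gt_eqF//.
set D := dist0 [set _ | _ in _].
have D0 : 0 <= D by exact: dist0_ge0.
have D20 : 0 <= D ^+ 2 by exact: expe_ge0.
have pV0 : 0 <= (p^-1)%:E :> \bar R by rewrite lee_fin invr_ge0 ltW.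
have om_p : 0 <= omega p by apply: om_ge0; exact: ltW.
have phi_p : 0 <= (p^-1)%:E * phi (D ^+ 2) by rewrite mule_ge0// phi_ge0.
have [p0p|pp0] := leP p0 p.
  left; apply: (@le_trans _ _ (omega p)); last by rewrite leeDr.
  apply: le_trans (om_mono _ _ (ltW p00) p0p).
  have [] := growth p0; first by rewrite ltW.
  by move=> _; apply: le_trans; rewrite lee_fin ge_min lexx.
have [sD|Ds] := leP s%:E (D ^+ 2).
  left; apply: (@le_trans _ _ ((p^-1)%:E * phi (D ^+ 2))); last first.
    by rewrite leeDl.
  apply: (@le_trans _ _ ((p^-1)%:E * (phi0 * s)%:E)).
    rewrite -EFinM lee_fin ge_min; apply/orP; right.
    by rewrite ler_wpM2r ?mulr_ge0 ?ltW// ltf_pV2.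
  apply: lee_wpmul2l => //; apply: (@le_trans _ _ (phi s%:E)).
    by have [] := growth s; first by rewrite ltW.
  by apply: phi_mono => //; rewrite lee_fin ltW.
have [r r0 Dr] : exists2 r, (0 <= r)%R & D = r%:E.
  by case: (D) D0 Ds => [r| |] //; rewrite lee_fin; exists r.
rewrite Dr -EFin_expe lte_fin in Ds.
have rdelta : (r < delta / 2)%R.
  rewrite -(@ltr_pXn2r _ 2) ?nnegrE// ?divr_ge0 ?ltW//.
  by apply: lt_le_trans Ds _; rewrite expr_div_n; lra.
have Gx : dist0 (G x) <= (r + p * `|w|)%:E.
  rewrite EFinD -Dr; apply: le_trans (dist0_translate _ (p *: w)) _.
  by rewrite normrZ gtr0_norm.
have pw : (p * `|w| <= p0 * `|w|)%R by rewrite ler_wpM2r// ltW.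
right; exists r; split => //.
  by apply: le_lt_trans Gx _; rewrite lte_fin; lra.
rewrite Dr -EFin_expe EFinD EFinM.
have [] := growth (r ^+ 2)%R; first by rewrite sqr_ge0/= (le_trans (ltW Ds)).
move=> phir _; have [] := growth p.
  by rewrite ltW//= (le_trans (ltW pp0)).
by move=> _ omp; apply: leeD => //; exact: lee_wpmul2l.
Qed.

Lemma singular_penalty_gt (R : realType) (X : metricType R)
  (Y : normedModType R) (A : set X) (f : X -> \bar R) (G : X -> set Y)
  (w : Y) (phi : \bar R -> \bar R) (omega : R -> \bar R)
  (fstar delta phi0 omega0 t0 mu lambda1 : R) :
  penalty_phi phi -> penalty_omega omega ->
  (0 < delta)%R -> (0 < phi0)%R -> (0 < omega0)%R -> (0 < t0)%R ->
  (forall t : R, (0 <= t <= t0)%R ->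
     (phi0 * t)%:E <= phi t%:E /\ (omega0 * t)%:E <= omega t) ->
  (forall x, f x != -oo) -> (0 <= mu)%R ->
  (forall x, A x -> dist0 (G x) < delta%:E ->
     fstar%:E <= f x + mu%:E * dist0 (G x)) ->
  (0 <= lambda1)%R -> penalty_bounded_below A f G w phi omega lambda1 ->
  exists2 lambda : R, (0 < lambda)%R &
    forall x p, A x -> (0 < p)%R ->
      fstar%:E < singular_penalty A f G w phi omega lambda x p.
Proof.
move=> phiP omP del0 phi00 om00 t00 growth fNy mu0 loc lam10 [c cP].
have [eta eta0 etaP] :=
  penalty_term_ge A G w phiP omP del0 phi00 om00 t00 growth.
(* [lam2] lifts the lower bound [c] strictly above [fstar] when the penalty is at least [eta].
   Otherwise [lam3] pays for [mu * r], and [lam4] for [mu * p * |w|] with a surplus [p]. *)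
pose lam2 := ((`|fstar - c| + 1) / eta)%R.
pose lam3 := (mu ^+ 2 / phi0)%R.
pose lam4 := ((mu * `|w| + 1) / omega0)%R.
have lam20 : (0 < lam2)%R by rewrite divr_gt0// ltr_wpDl.
have lam30 : (0 <= lam3)%R by rewrite divr_ge0 ?sqr_ge0 ?ltW.
have lam40 : (0 <= lam4)%R by rewrite divr_ge0 ?addr_ge0 ?mulr_ge0 ?(ltW om00).
exists (lambda1 + lam2 + lam3 + lam4)%R; first lra.
move=> x p Ax p0; have := etaP x p p0; have := cP x p Ax (ltW p0).
rewrite /singular_penalty; set V := penalty_term _ _ _ _ _ _ _.
set lam := (lambda1 + _ + _ + _)%R.
have lam0 : (0 < lam)%R by rewrite /lam; lra.
have V0 : 0 <= V.
  rewrite /V /penalty_term gt_eqF//; case: phiP omP => phi_ge0 _ _ [om_ge0 _ _].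
  rewrite adde_ge0 ?om_ge0 ?mule_ge0 ?phi_ge0 ?expe_ge0 ?dist0_ge0//.
    by rewrite lee_fin invr_ge0 ltW.
  exact: ltW.
case: (V) V0 => [v v0 fc|_ _ _|] //; last first.
  by rewrite gt0_muley ?lte_fin// addey ?fNy// ltry.
case fx : (f x) (fNy x) fc => [t| |] // _; last by rewrite ltry.
rewrite -!EFinM -!EFinD !lee_fin lte_fin => fc [etav|[r [r0 Gdel Gr rv]]].
  have : (lam2 * eta <= lam2 * v)%R by rewrite ler_pM2l.
  rewrite {1}/lam2 divfK ?gt_eqF// => lam2v.
  have := mulr_ge0 (addr_ge0 lam30 lam40) (v0 : 0 <= v)%R.
  have := ler_norm (fstar - c); rewrite /lam; lra.
rewrite lee_fin in rv.
have := le_trans (loc x Ax Gdel) (leeD2l _ (lee_wpmul2l _ Gr)).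
rewrite fx lee_fin => /(_ mu0); rewrite -EFinM -EFinD lee_fin => fr.
have /(ler_wpM2l (ltW lam0)) := rv.
(* The loss [p / 4] is less than the surplus [p] provided by [lam4], and what remains makes the
   final inequality strict. *)
have AMGM : (mu * r <= p^-1 * (mu * r) ^+ 2 + p / 4)%R.
  rewrite -subr_ge0.
  have -> : (p^-1 * (mu * r) ^+ 2 + p / 4 - mu * r =
             p^-1 * (mu * r - p / 2) ^+ 2)%R by field; rewrite gt_eqF.
  by rewrite mulr_ge0 ?sqr_ge0// invr_ge0 ltW.
have r2 : (0 <= p^-1 * r ^+ 2)%R by rewrite mulr_ge0 ?sqr_ge0// invr_ge0 ltW.
have : (mu ^+ 2 * (p^-1 * r ^+ 2) <= lam * phi0 * (p^-1 * r ^+ 2))%R.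
  apply: ler_wpM2r => //; rewrite -ler_pdivrMr// -/lam3 /lam; lra.
have : ((mu * `|w| + 1) * p <= lam * omega0 * p)%R.
  apply: ler_wpM2r; first exact: ltW.
  by rewrite -ler_pdivrMr// -/lam4 /lam; lra.
rewrite exprMn in AMGM; lra.
Qed.

(** * The slice [p = 0] and global exactness *)

Lemma singular_penalty_feasible (R : realType) (X : metricType R)
  (Y : normedModType R) (A : set X) (f : X -> \bar R) (G : X -> set Y) (w : Y)
  (phi : \bar R -> \bar R) (omega : R -> \bar R) (lambda : R) (x : X) :
  feasible A G x -> singular_penalty A f G w phi omega lambda x 0 = f x.
Proof.
move=> xF; rewrite /singular_penalty /penalty_term eqxx; case: ifP => [_|].
  by rewrite mule0 adde0.
by move/asboolPn.
Qed.

Lemma singular_penalty_infeasible (R : realType) (X : metricType R)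
  (Y : normedModType R) (A : set X) (f : X -> \bar R) (G : X -> set Y) (w : Y)
  (phi : \bar R -> \bar R) (omega : R -> \bar R) (lambda : R) (x : X) :
  (0 < lambda)%R -> f x != -oo -> ~ feasible A G x ->
  singular_penalty A f G w phi omega lambda x 0 = +oo.
Proof.
move=> lam0 fx xF; rewrite /singular_penalty /penalty_term eqxx.
case: ifP => [/asboolP //|_].
by rewrite gt0_muley ?lte_fin// addey.
Qed.

(** On the slice [p = 0] the penalty function is [f] on the feasible set and, since [lambda] is
    positive, [+oo] off it. As its values for [p > 0] exceed [fstar], only optimal solutions at
    [p = 0] can minimize it. *)
Lemma globally_exact_of_gt (R : realType) (X : metricType R)
  (Y : normedModType R) (A : set X) (f : X -> \bar R) (G : X -> set Y) (w : Y)
  (phi : \bar R -> \bar R) (omega : R -> \bar R) (fstar lambda : R) :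
  (forall x, f x != -oo) -> optimal_value A f G fstar -> (0 < lambda)%R ->
  (forall x p, A x -> (0 < p)%R ->
     fstar%:E < singular_penalty A f G w phi omega lambda x p) ->
  globally_exact A f G w phi omega.
Proof.
move=> fNy [xs [xsF xsmin] fxs] lam0 gt_fstar.
pose F := singular_penalty A f G w phi omega lambda.
have Fge x p : A x -> (0 <= p)%R -> fstar%:E <= F x p.
  move=> Ax; rewrite le_eqVlt => /predU1P[<-|p0]; last exact/ltW/gt_fstar.
  have [xF|xF] := pselect (feasible A G x).
    by rewrite /F singular_penalty_feasible// -fxs xsmin.
  by rewrite /F singular_penalty_infeasible// leey.
have opt_min x : optimal_solution A f G x ->
    global_minimizer A f G w phi omega lambda x 0.
  move=> [xF xmin]; split=> //; first by have [] := xF.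
  move=> y q Ay q0; rewrite singular_penalty_feasible//.
  by apply: le_trans (xmin _ xsF) _; rewrite fxs; exact: Fge.
have xs_opt : optimal_solution A f G xs by split.
exists lambda; first exact: ltW.
split; first by exists xs, 0%R; exact: opt_min.
move=> x p; split=> [[Ax p0 xpmin]|[-> /opt_min]//].
(* Comparison with [(xs, 0)]; this bound then excludes both [p > 0] and infeasible [x]. *)
have : F x p <= fstar%:E.
  by rewrite -fxs -(singular_penalty_feasible f w phi omega lambda xsF);
    apply: xpmin => //; have [] := xsF.
move: p0; rewrite le_eqVlt => /predU1P[<-|p0]; last first.
  by rewrite leNgt gt_fstar.
have [xF|xF] := pselect (feasible A G x); last first.
  by rewrite /F singular_penalty_infeasible.
rewrite /F singular_penalty_feasible// => fx; split=> //; split=> // y yF.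
by apply: le_trans fx _; rewrite -fxs; exact: xsmin.
Qed.

Theorem theorem4p9 (R : realType) (X : completeMetricType R)
  (Y : normedModType R) (A : set X) (f : X -> \bar R) (G : X -> set Y)
  (fstar : R) (w : Y) (phi : \bar R -> \bar R) (omega : R -> \bar R)
  (delta lambda0 : R)
  (A_nonempty : A !=set0)
  (f_neqNy : forall x, f x != -oo)
  (G_closed : forall x, closed (G x))
  (f_min : optimal_value A f G fstar)
  (phiP : penalty_phi phi)
  (omegaP : penalty_omega omega)
  (A_closed : closed A)
  (f_lsc : forall x, A x -> lsc_at f x)
  (dG_lsc : forall x, A x -> lsc_at (fun y => dist0 (G y)) x)
  (delta_gt0 : (0 < delta)%R)
  (lambda0_ge0 : (0 <= lambda0)%R)
  (f_lip : lipschitz_continuous_on (Kset A f G fstar delta lambda0) f)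
  (f_usc : forall x, Kset A f G fstar delta lambda0 x -> usc_at f x)
  (dG_descent : exists2 a : R, (0 < a)%R &
     forall x, Kset A f G fstar delta lambda0 x ->
       steepest_descent_rate A (fun y => dist0 (G y)) x < (- a)%:E)
  (phi_omega_growth : exists phi0 Phi0 omega0 Omega0 t0 : R,
     [/\ (0 < phi0)%R, (0 < Phi0)%R, (0 < omega0)%R, (0 < Omega0)%R &
         (0 < t0)%R] /\
     forall t : R, (0 <= t <= t0)%R ->
       [/\ (phi0 * t)%:E <= phi t%:E, phi t%:E <= (Phi0 * t)%:E,
           (omega0 * t)%:E <= omega t & omega t <= (Omega0 * t)%:E]) :
  globally_exact A f G w phi omega <->
  exists2 lambda : R, (0 <= lambda)%R &
    penalty_bounded_below A f G w phi omega lambda.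
Proof.
split.
  move=> [lambda lam0 [[x [p xp]] minP]]; exists lambda => //.
  have [p0 [xF xmin]] := (minP x p).1 xp; subst p.
  have [xs [xsF xsmin] fxs'] := f_min.
  (* The minimizer sits at [p = 0] with [x] feasible, so the minimum of the penalty function is
     [f x], which is at least [fstar]. *)
  exists fstar => y q Ay q0.
  have [_ _ /(_ y q Ay q0)] := xp; rewrite singular_penalty_feasible//.
  by apply: le_trans; rewrite -fxs'; exact: xsmin.
move=> [lambda1 lam10 bounded].
have [a a0 desc] := dG_descent.
have [phi0 [Phi1 [omega0 [omega1 [t0 [[phi00 _ om00 _ t00] growth]]]]]] :=
  phi_omega_growth.
have [mu mu0 loc] := local_linear_penalty A_closed lambda0_ge0 a0 f_neqNy
  (fun x => dist0_ge0 (G x)) f_lsc dG_lsc f_lip f_usc desc.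
have growth_ge t : (0 <= t <= t0)%R ->
    (phi0 * t)%:E <= phi t%:E /\ (omega0 * t)%:E <= omega t.
  by move=> /growth [].
have [lambda lam0 gt_fstar] := singular_penalty_gt phiP omegaP delta_gt0
  phi00 om00 t00 growth_ge f_neqNy mu0 loc lam10 bounded.
exact: globally_exact_of_gt f_neqNy f_min lam0 gt_fstar.
Qed.
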